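(* Let $\|\cdot\|_O$ be an observer's norm with associated scattering norm $\|\cdot\|_S$ and scattering spaces $S(C)$. Let $f$ be a scattering solution, relative to $\|\cdot\|_O$, of $\partial_t f+\xi\cdot\nabla_x f=I(f,x,\xi,t)$, $f(x,\xi,0)=f_0(x,\xi)$, and let $$N=\|f(x,\xi,0)\|_O+\Big\|\int_0^\infty|I(f,x+t\xi,\xi,t)|\,dt\Big\|_O<\infty.$$ Then there exists a unique solution $f_\infty\in S(N)$ of the linear transport equation $\partial_t f_\infty+\xi\cdot\nabla_x f_\infty=0$ such that, for every compact subset $D\subset\mathbb{R}^n$ of the spatial variable, $$\lim_{t\to\infty}\big\|\chi_D(x)\big(f(x+t\xi,\xi,t)-f_\infty(x,\xi,0)\big)\big\|_O=0.$$
   Context: Here $x,\xi\in\mathbb{R}^n$, $t\in[0,\infty)$, and $\chi_D$ is the indicator function of $D\subset\mathbb{R}^n$. The equation is equivalently understood along characteristics, i.e. $f(x+t\xi,\xi,t)=f_0(x,\xi)+\int_0^t I(f,x+s\xi,\xi,s)\,ds$; $f$ is expected to be non-negative. $I(f,x,\xi,t)$ is a mesoscopic interaction, meaning $\int_{\mathbb{R}^n} I(f,x,\xi,t)\,d\xi=0$, $\int_{\mathbb{R}^n} I(f,x,\xi,t)|\xi|^2\,d\xi=0$ and $\int_{\mathbb{R}^n} I(f,x,\xi,t)\xi_i\,d\xi=0$ for $1\le i\le n$. Observer's norm: a norm $\|\cdot\|_O$ acting on the $(x,\xi)$ variables for fixed time $t$ (so its value $\|f\|_O(t)$ may depend on $t$),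 such that if $\|f\|_O(t)<\infty$ then the interaction $I(f,x,\xi,t)$ is well defined and $\iint f(x,\xi,t)\,dx\,d\xi$, $\iint f(x,\xi,t)\xi\,dx\,d\xi$, $\iint f(x,\xi,t)|\xi|^2\,dx\,d\xi$ are convergent. Scattering norm: $\|f\|_S=\sup_t\|f(x+t\xi,\xi,t)\|_O$. Scattering space: for $C>0$, $f\in S(C)$ if and only if $\|f\|_S\le C$; $S(C)$ is identified with its completion. Scattering solution relative to $\|\cdot\|_O$: a solution $f$ with $\|f(x,\xi,0)\|_O+\big\|\int_0^\infty|I(f,x+t\xi,\xi,t)|\,dt\big\|_O<\infty$ and, for every bounded $D\subset\mathbb{R}^n$, $\lim_{z\to\infty}\big\|\chi_D(x)\int_z^\infty|I(f,x+t\xi,\xi,t)|\,dt\big\|_O=0$.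
   Formalization: The observer's norm is additionally assumed monotone in the modulus (|g| ≤ |h| a.e. implies ‖g‖_O ≤ ‖h‖_O); without this the claim f_∞ ∈ S(N) can fail, e.g. for a weighted L¹ norm plus the modulus of a bounded linear functional. *)

(* Defs.v *)
From HB Require Import structures.
From mathcomp Require Import all_boot all_order all_algebra.
From mathcomp Require Import all_classical all_reals all_analysis.
From mathcomp Require Import measurable_realfun.

Set Implicit Arguments.
Unset Strict Implicit.
Unset Printing Implicit Defensive.

Import Order.TTheory GRing.Theory Num.Theory.
Import numFieldNormedType.Exports.

Local Open Scope classical_set_scope.
Local Open Scope ring_scope.

(* The Borel sigma-algebra of R^n, presented as the product sigma-algebra:
   it is generated by the coordinates. *)
Definition rV_display : measure_display.
Proof. exact: default_measure_display. Qed.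

Section rV_measurable.
Context (R : realType) (n : nat).

Definition rV_coord (i : 'I_n) (x : 'rV[R]_n) : measurableTypeR R := x ord0 i.

Let rV_set0 : g_sigma_preimage rV_coord set0.
Proof. exact: sigma_algebra0. Qed.

Let rV_setC A : g_sigma_preimage rV_coord A -> g_sigma_preimage rV_coord (~` A).
Proof. exact: sigma_algebraC. Qed.

Let rV_bigcup (F : (set 'rV[R]_n)^nat) :
  (forall i, g_sigma_preimage rV_coord (F i)) ->
  g_sigma_preimage rV_coord (\bigcup_i (F i)).
Proof. exact: sigma_algebra_bigcup. Qed.

HB.instance Definition _ := @isMeasurable.Build rV_display
  'rV[R]_n (g_sigma_preimage rV_coord) rV_set0 rV_setC rV_bigcup.

Lemma measurable_rV_coord (i : 'I_n) :
  measurable_fun [set: 'rV[R]_n] (rV_coord i).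
Proof.
move=> _ Y mY; rewrite setTI; apply: sub_sigma_algebra => /=.
rewrite -bigcup_seq/=; exists i => /=; first by rewrite mem_index_enum.
by exists Y => //; rewrite setTI.
Qed.

Lemma measurable_fun_rVP d (T : measurableType d) (f : T -> 'rV[R]_n) :
  (forall i, measurable_fun [set: T] (rV_coord i \o f)) ->
  measurable_fun [set: T] f.
Proof.
move=> mf _ A mA; rewrite setTI.
have : preimage_set_system [set: T] f (g_sigma_preimage rV_coord) `<=`
    measurable.
  rewrite -g_sigma_preimageE.
  apply: smallest_sub; first exact: sigma_algebra_measurable.
  move=> B [C].
  rewrite -bigcup_seq/= => -[i _ [D mD <-]] <-.
  by rewrite setTI setTI; rewrite -[X in measurable X]setTI; exact: mf.
by apply; exists A => //; rewrite setTI.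
Qed.

End rV_measurable.

Section lebesgue_rV.
Context {R : realType}.

Definition rV_cons n (p : measurableTypeR R * 'rV[R]_n) : 'rV[R]_n.+1 :=
  \row_i (if unlift ord0 i is Some j then p.2 ord0 j else p.1).

Definition rV_uncons n (x : 'rV[R]_n.+1) : measurableTypeR R * 'rV[R]_n :=
  (x ord0 ord0, \row_j x ord0 (lift ord0 j)).

Lemma rV_consK n : cancel (@rV_cons n) (@rV_uncons n).
Proof.
move=> [a x]; rewrite /rV_uncons mxE unlift_none; congr pair.
by apply/rowP => j; rewrite !mxE liftK.
Qed.

Lemma rV_unconsK n : cancel (@rV_uncons n) (@rV_cons n).
Proof.
move=> x; apply/rowP => i; rewrite mxE.
by case: unliftP => [j ->|->] //=; rewrite mxE.
Qed.

Lemma measurable_rV_cons n : measurable_fun [set: _] (@rV_cons n).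
Proof.
apply: measurable_fun_rVP => i.
rewrite (_ : _ \o _ = fun p : measurableTypeR R * 'rV[R]_n =>
    if unlift ord0 i is Some j then rV_coord j p.2 else p.1); last first.
  by apply/funext => p; rewrite /rV_coord /= mxE.
case: unliftP => [j _|_]; last exact: measurable_fst.
by apply: measurableT_comp; [exact: measurable_rV_coord|exact: measurable_snd].
Qed.

Lemma measurable_rV_uncons n : measurable_fun [set: _] (@rV_uncons n).
Proof.
apply: measurable_fun_pair; first exact: (measurable_rV_coord ord0).
apply: measurable_fun_rVP => i.
rewrite (_ : _ \o _ = rV_coord (lift ord0 i)); first exact: measurable_rV_coord.
by apply/funext => x; rewrite /rV_coord /= mxE.
Qed.

Section step.
Context n (mu : {sigma_finite_measure set 'rV[R]_n -> \bar R}).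

Definition rV_prod_measure : set 'rV[R]_n.+1 -> \bar R :=
  pushforward (@lebesgue_measure R \x mu)%E (@rV_cons n).

Let m0 : rV_prod_measure set0 = 0%E.
Proof. by rewrite /rV_prod_measure /pushforward preimage_set0 measure0. Qed.

Let m_ge0 A : (0 <= rV_prod_measure A)%E.
Proof. by rewrite /rV_prod_measure /pushforward; apply: measure_ge0. Qed.

Let m_sigma_additive : semi_sigma_additive rV_prod_measure.
Proof.
move=> F mF tF mUF; rewrite /rV_prod_measure /pushforward preimage_bigcup.
have mc A : measurable A -> measurable (@rV_cons n @^-1` A).
  by move=> mA; rewrite -[X in measurable X]setTI; exact: measurable_rV_cons.
apply: measure_semi_sigma_additive.
- by move=> k; exact: mc.
- apply/trivIsetP => /= i j _ _ ij; rewrite -preimage_setI.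
  by move/trivIsetP : tF => /(_ _ _ _ _ ij) ->//; rewrite preimage_set0.
- by rewrite -preimage_bigcup; exact: mc.
Qed.

HB.instance Definition _ := isMeasure.Build _ _ _ rV_prod_measure
  m0 m_ge0 m_sigma_additive.

Let m_sigma_finite : sigma_finite setT rV_prod_measure.
Proof.
have /sigma_finiteP[F [TF ndF Foo]] := sigma_finiteT (@lebesgue_measure R).
have /sigma_finiteP[G [TG ndG Goo]] := sigma_finiteT mu.
exists (fun k => @rV_uncons n @^-1` (F k `*` G k)).
  rewrite -preimage_bigcup (_ : \bigcup_k _ = setT) ?preimage_setT//.
  rewrite -subTset => -[x y] _.
  have [k _ Fkx] : (\bigcup_k F k) x by rewrite -TF.
  have [l _ Gly] : (\bigcup_k G k) y by rewrite -TG.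
  exists (maxn k l) => //; split => /=.
  - by move: x Fkx; exact/subsetPset/ndF/leq_maxl.
  - by move: y Gly; exact/subsetPset/ndG/leq_maxr.
move=> k; have [mF Fkoo] := Foo k; have [mG Gkoo] := Goo k.
split.
  rewrite -[X in measurable X]setTI; apply: measurable_rV_uncons => //.
  exact: measurableX.
rewrite /rV_prod_measure /pushforward -comp_preimage.
rewrite (_ : _ \o _ = id) ?preimage_id; last first.
  by apply/funext => p; rewrite /= rV_consK.
by rewrite product_measure1E// lte_mul_pinfty// ge0_fin_numE.
Qed.

HB.instance Definition _ := Measure_isSigmaFinite.Build _ _ _ rV_prod_measure
  m_sigma_finite.

End step.

(* Lebesgue measure on R^n, as the n-fold product of Lebesgue measure on R. *)
Fixpoint lebesgue_rV n : {sigma_finite_measure set 'rV[R]_n -> \bar R} :=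
  match n with
  | 0 => \d_(0 : 'rV[R]_0)
  | n'.+1 => rV_prod_measure (lebesgue_rV n')
  end.

Lemma lebesgue_rV_box n (A : 'I_n -> set (measurableTypeR R)) :
  (forall i, measurable (A i)) ->
  lebesgue_rV n [set x : 'rV[R]_n | forall i, A i (x ord0 i)] =
  (\prod_(i < n) lebesgue_measure (A i))%E.
Proof.
elim: n A => [|n IHn] A mA.
  rewrite big_ord0 /= diracE (_ : [set _ | _] = setT) ?in_setT//.
  by apply/seteqP; split => // x _ [].
rewrite big_ord_recl -IHn; last by move=> i; exact: mA.
rewrite /= /rV_prod_measure /pushforward.
rewrite -product_measure1E//; last first.
  rewrite (_ : [set _ | _] =
      \bigcap_(i in [set: 'I_n]) (rV_coord i @^-1` A (lift ord0 i))).
    apply: fin_bigcap_measurable => // i _.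
    by rewrite -[X in measurable X]setTI; exact: measurable_rV_coord.
  by apply/seteqP; split => [x h i _|x h i]; [exact: h|exact: (h i)].
congr (_ _); apply/seteqP; split => [[a x] /= h|[a x] /= [h0 h] i].
  split; first by have := h ord0; rewrite mxE unlift_none.
  by move=> i; have := h (lift ord0 i); rewrite mxE liftK.
by rewrite mxE; case: unliftP => [j ->|->].
Qed.

End lebesgue_rV.

Section kinetic.
Context {R : realType} {n : nat}.

Local Notation E := 'rV[R]_n.
Local Notation leb := (@lebesgue_measure R).
Local Notation mu := (lebesgue_rV n).
Local Notation mu2 := (lebesgue_rV n \x lebesgue_rV n)%E.

(* A phase-space density is evaluated as [f t (x, xi)].  Functions of (x, xi)
   are Borel measurable and identified when equal almost everywhere. *)
Definition density := R -> E * E -> R.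

Definition free_flow (t : R) (z : E * E) : E * E := (z.1 + t *: z.2, z.2).

Definition sqr_speed (xi : E) : R := \sum_(i < n) xi ord0 i ^+ 2.

(* [I f t (x, xi)] stands for I(f,x,xi,t).  An interaction is only partially
   defined: its values at time [t] are meaningful when [well_defined I f t]. *)
Record interaction := Interaction {
  well_defined : density -> R -> Prop ;
  interaction_value :> density -> density }.

Definition no_interaction : interaction :=
  {| well_defined := fun _ _ => True ;
     interaction_value := fun _ _ _ => 0 |}.

Definition vanishing_moment (h w : E -> R) : Prop :=
  mu.-integrable [set: E] (fun xi => (h xi * w xi)%:E) /\
  \int[mu]_xi (h xi * w xi) = 0.

Definition mesoscopic (I : interaction) : Prop :=
  forall (f : density) (t : R), 0 <= t -> well_defined I f t ->
  {ae mu, forall x,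
    [/\ vanishing_moment (fun xi => I f t (x, xi)) (fun=> 1),
        vanishing_moment (fun xi => I f t (x, xi)) sqr_speed &
        forall i, vanishing_moment (fun xi => I f t (x, xi))
                                   (fun xi => xi ord0 i)]}.

(* A norm on functions of (x, xi), with value +oo outside the associated normed
   space.  As usual for norms on function spaces, it depends monotonically on
   the modulus of the function. *)
Record function_norm (O : (E * E -> R) -> \bar R) : Prop := FunctionNorm {
  fnorm_ge0 : forall g : E * E -> R, measurable_fun [set: E * E] g -> (0 <= O g)%E ;
  fnorm_eq0 : forall g : E * E -> R, measurable_fun [set: E * E] g -> O g = 0%E ->
    {ae mu2, forall z, g z = 0} ;
  fnormZ : forall (c : R) (g : E * E -> R), measurable_fun [set: E * E] g ->
    O (fun z => c * g z) = (`|c|%:E * O g)%E ;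
  fnormD : forall g h : E * E -> R, measurable_fun [set: E * E] g ->
    measurable_fun [set: E * E] h ->
    (O (fun z => g z + h z)%R <= O g + O h)%E ;
  fnorm_le : forall g h : E * E -> R, measurable_fun [set: E * E] g ->
    measurable_fun [set: E * E] h ->
    {ae mu2, forall z, `|g z| <= `|h z|} -> (O g <= O h)%E }.

Record observer_norm (I : interaction) (O : (E * E -> R) -> \bar R) : Prop :=
  ObserverNorm {
  observer_norm_norm : function_norm O ;
  observer_norm_defined : forall (f : density) (t : R), 0 <= t ->
    measurable_fun [set: E * E] (f t) -> (O (f t) < +oo)%E ->
    well_defined I f t ;
  observer_norm_moments : forall g : E * E -> R, measurable_fun [set: E * E] g ->
    (O g < +oo)%E ->
    [/\ mu2.-integrable [set: E * E] (fun z => (g z)%:E),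
        forall i, mu2.-integrable [set: E * E] (fun z => (g z * z.2 ord0 i)%:E) &
        mu2.-integrable [set: E * E] (fun z => (g z * sqr_speed z.2)%:E)] }.

(* Value of the norm on a function which may be infinite: it is +oo unless the
   function is finite almost everywhere. *)
Definition enorm (O : (E * E -> R) -> \bar R) (g : E * E -> \bar R) : \bar R :=
  if `[< {ae mu2, forall z, g z \is a fin_num} >] then O (fine \o g) else +oo%E.

Definition scattering_norm (O : (E * E -> R) -> \bar R) (f : density) : \bar R :=
  ereal_sup [set O (f t \o free_flow t) | t in [set t | 0 <= t]].

Definition scattering_space (O : (E * E -> R) -> \bar R) (C : R) : set density :=
  [set f | (forall t : R, 0 <= t -> measurable_fun [set: E * E] (f t)) /\
           (scattering_norm O f <= C%:E)%E].

Lemma measurable_free_flow (t : R) : measurable_fun [set: E * E] (free_flow t).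
Proof.
apply: measurable_fun_pair; last exact: measurable_snd.
apply: measurable_fun_rVP => i.
rewrite (_ : _ \o _ = fun z : E * E =>
    (rV_coord i z.1 : R) + t * (rV_coord i z.2 : R)); last first.
  by apply/funext => z; rewrite /rV_coord /= !mxE.
apply: measurable_funD => /=.
  by apply: (measurableT_comp (measurable_rV_coord i)); exact: measurable_fst.
apply: measurable_funM => //=.
by apply: (measurableT_comp (measurable_rV_coord i)); exact: measurable_snd.
Qed.

(* Limits in scattering norm of elements of the scattering space remain in it:
   completing the space adds no further density to it. *)
Lemma scattering_space_closed (O : (E * E -> R) -> \bar R) (C : R)
    (u : nat -> density) (f : density) :
  function_norm O -> (forall k, scattering_space O C (u k)) ->
  (forall t : R, 0 <= t -> measurable_fun [set: E * E] (f t)) ->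
  scattering_norm O (fun t z => f t z - u k t z) @[k --> \oo] --> 0%E ->
  scattering_space O C f.
Proof.
move=> nO uC mf u0; split => //; apply: ge_ereal_sup => _ [t /= t0 <-].
have mflow (g : E * E -> R) : measurable_fun [set: E * E] g ->
    measurable_fun [set: E * E] (g \o free_flow t).
  by move=> mg; exact: (measurableT_comp mg (measurable_free_flow t)).
have le_k k : (O (f t \o free_flow t) <=
    C%:E + scattering_norm O (fun t z => f t z - u k t z)%R)%E.
  have [mu_ uC_] := uC k.
  rewrite (_ : _ \o _ = fun z => ((u k t \o free_flow t) z +
      ((fun z => f t z - u k t z) \o free_flow t) z)%R); last first.
    by apply/funext => z /=; rewrite addrC subrK.
  apply: le_trans (fnormD nO (mflow _ (mu_ _ t0)) _) _.
    apply: (mflow (fun z => f t z - u k t z)).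
    by apply: measurable_funB; [exact: mf|exact: mu_].
  apply: leeD; last by apply: ereal_sup_ubound; exists t.
  by apply: le_trans uC_; apply: ereal_sup_ubound; exists t.
have cvgC : (C%:E + scattering_norm O (fun t z => f t z - u k t z)%R)%E
    @[k --> \oo] --> C%:E.
  by rewrite -[X in _ --> X]adde0; apply: cvgeD => //; exact: cvg_cst.
rewrite -(cvg_lim _ cvgC)//; apply: lime_ge; first by apply/cvg_ex; exists C%:E.
by apply: nearW.
Qed.

(* Solutions are understood along characteristics. *)
Definition solution (I : interaction) (f0 : E * E -> R) (f : density) : Prop :=
  [/\ forall t : R, 0 <= t -> measurable_fun [set: E * E] (f t),
      forall t : R, 0 <= t -> well_defined I f t,
      measurable_fun [set p : measurableTypeR R * (E * E) | 0 <= (p.1 : R)]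
        (fun p => I f p.1 p.2) &
      {ae mu2, forall z, forall t : R, 0 <= t ->
        leb.-integrable `[0, t] (fun s => (I f s (free_flow s z))%:E) /\
        f t (free_flow t z) =
          f0 z + \int[leb]_(s in `[0, t]) I f s (free_flow s z)}].

Definition abs_interaction (I : interaction) (f : density) (T : R)
    (z : E * E) : \bar R :=
  (\int[leb]_(s in `[T, +oo[) `|I f s (free_flow s z)|%:E)%E.

Definition scattering_bound (I : interaction) (O : (E * E -> R) -> \bar R)
    (f : density) : \bar R :=
  (O (f 0%R) + enorm O (abs_interaction I f 0))%E.

Definition scattering_solution (I : interaction) (O : (E * E -> R) -> \bar R)
    (f0 : E * E -> R) (f : density) : Prop :=
  [/\ solution I f0 f,
      (scattering_bound I O f < +oo)%E &
      forall D : set E, bounded_set D -> measurable D ->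
        enorm O (fun z => (\1_D z.1)%:E * abs_interaction I f T z)%E
          @[T --> +oo] --> 0%E].

(* [f] and [g] have the same large-time behaviour along the free flow, [g]
   being freely transported. *)
Definition scatters_to (O : (E * E -> R) -> \bar R) (f g : density) : Prop :=
  forall D : set E, compact D ->
    O (fun z => \1_D z.1 * (f t (free_flow t z) - g 0 z)) @[t --> +oo] --> 0%E.

End kinetic.
Arguments interaction : clear implicits.

(* Main.v *)
(** Along the characteristics z = (x, xi) |-> (x + t xi, xi) the solution is
    f(0, z) plus the integral of the interaction over [0, t].  The integral over
    the whole half-line converges absolutely almost everywhere, and
    G(z) = f(0, z) + int_0^oo I ds is the only possible scattering state: it is
    dominated by |f(0, z)| + int_0^oo |I| ds, whose norm is at most N, and its
    distance to f along the flow at time t is dominated by int_t^oo |I| ds.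
    Freely transporting G gives the asymptotic solution.  Uniqueness at time 0
    follows by exhausting space by boxes, and at other times because the free
    flow preserves Lebesgue measure, hence null sets. *)

Require Import Defs.
From mathcomp Require Import finmap.
From mathcomp Require Import all_boot all_order all_algebra.
From mathcomp Require Import all_classical all_reals all_analysis.
From mathcomp Require Import measurable_realfun.

Import Order.TTheory GRing.Theory Num.Theory.
Import numFieldNormedType.Exports.

Local Open Scope classical_set_scope.
Local Open Scope ring_scope.

(** * Translation invariance of Lebesgue measure on R and R^n *)

Section translation_invariance.
Context {R : realType}.

Lemma measurable_translation (a : R) :
  measurable_fun setT (fun x : measurableTypeR R => x + a : measurableTypeR R).
Proof. by apply: measurable_funD => //; exact: measurable_id. Qed.

(** The pushforward under translation gives each interval []b, c]] its length, and Lebesgue measure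
    is the only measure that does. *)
Lemma lebesgue_measure_translation (a : R) (A : set (measurableTypeR R)) :
  measurable A ->
  lebesgue_measure ((fun x => x + a) @^-1` A) = lebesgue_measure A.
Proof.
move=> mA.
have mD := measurable_translation a.
apply/esym; rewrite -[RHS]/(pushforward lebesgue_measure
  (fun x : measurableTypeR R => x + a : measurableTypeR R) A).
apply: lebesgue_measure_unique => //= _ [[b c]] _ <-.
rewrite /pushforward.
rewrite (_ : _ @^-1` _ = `]b - a, c - a]%classic); last first.
  by apply/seteqP; split => x; rewrite /= !in_itv/= ltrBlDr lerBrDr.
by rewrite !lebesgue_measure_itv/= !lte_fin ltrD2r -!EFinB opprB addrA subrK.
Qed.

Lemma measurable_rV_translation {n : nat} (a : 'rV[R]_n) :
  measurable_fun setT (fun x : 'rV[R]_n => x + a).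
Proof.
apply: measurable_fun_rVP => i.
rewrite (_ : _ \o _ = fun x => (rV_coord i x : R) + a ord0 i); last first.
  by apply/funext => x; rewrite /rV_coord /= !mxE.
by apply: measurable_funD => //; exact: measurable_rV_coord.
Qed.

(** Induction on the dimension: through [rV_cons] a translation acts separately on the first
    coordinate and on the rest, and a product measure is determined by its values on rectangles. *)
Lemma lebesgue_rV_translation {n : nat} (a : 'rV[R]_n) (A : set 'rV[R]_n) :
  measurable A -> lebesgue_rV n ((fun x => x + a) @^-1` A) = lebesgue_rV n A.
Proof.
elim: n a A => [|n IHn] a A mA.
  (* R^0 has a single point, so the two sets coincide. *)
  by congr (_ _); apply/seteqP; split=> x /=; rewrite (thinmx0 (x + a)) (thinmx0 x).
pose a0 := a ord0 ord0; pose a' := (rV_uncons a).2.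
pose tr (p : measurableTypeR R * 'rV[R]_n) : measurableTypeR R * 'rV[R]_n :=
  (p.1 + a0, p.2 + a').
have mtr : measurable_fun setT tr.
  apply: measurable_fun_pair.
    by apply: measurable_funD => //; exact: measurable_fst.
  exact: (measurableT_comp (measurable_rV_translation a') measurable_snd).
have mcA : measurable (@rV_cons R n @^-1` A).
  by rewrite -[X in measurable X]setTI; exact: measurable_rV_cons.
have trE p : rV_cons p + a = rV_cons (tr p).
  rewrite -[LHS]rV_unconsK; congr rV_cons.
  rewrite /rV_uncons /tr !mxE unlift_none; congr pair.
  by apply/rowP => j; rewrite !mxE liftK.
rewrite /= /rV_prod_measure /pushforward.
rewrite (_ : _ @^-1` (_ @^-1` A) = tr @^-1` (@rV_cons R n @^-1` A)); last first.
  by apply/funext => p; rewrite /preimage /= trE.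
rewrite -[LHS]/(pushforward (@lebesgue_measure R \x lebesgue_rV n)%E tr _).
apply/esym/product_measure_unique => // B C mB mC.
rewrite -[LHS]/((lebesgue_measure \x lebesgue_rV n)%E
  (((fun x => x + a0) @^-1` B) `*` ((fun x => x + a') @^-1` C))).
have mB' : measurable ((fun x : measurableTypeR R => x + a0) @^-1` B).
  by rewrite -[X in measurable X]setTI; exact: measurable_translation.
have mC' : measurable ((fun x : 'rV[R]_n => x + a') @^-1` C).
  by rewrite -[X in measurable X]setTI; exact: measurable_rV_translation.
rewrite product_measure1E// ?IHn//; congr (_ * _)%E.
exact: lebesgue_measure_translation.
Qed.

End translation_invariance.

(** * Invariance of phase-space measure under the free flow *)

Section free_flow.
Context {R : realType} {n : nat}.
Local Notation E := 'rV[R]_n.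
Local Notation mu := (lebesgue_rV n).
Local Notation mu2 := (lebesgue_rV n \x lebesgue_rV n)%E.

Lemma free_flowK (t : R) : cancel (@free_flow R n t) (free_flow (- t)).
Proof. by move=> [x v]; rewrite /free_flow /= scaleNr addrK. Qed.

Lemma free_flowNK (t : R) : cancel (free_flow (- t)) (@free_flow R n t).
Proof. by move=> [x v]; rewrite /free_flow /= scaleNr subrK. Qed.

(* The velocity is frozen, so each velocity slice is merely translated. *)
Lemma free_flow_measure (t : R) (A : set (E * E)) :
  measurable A -> mu2 (free_flow t @^-1` A) = mu2 A.
Proof.
move=> mA.
(* Reversing the order of integration puts the velocity outside, leaving position slices at fixed
   velocity. *)
have swap B : measurable B -> mu2 B = (mu \x^ mu)%E B.
  by apply: product_measure_unique => C D mC mD /=; rewrite product_measure2E.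
have mtA : measurable (free_flow t @^-1` A).
  by rewrite -[X in measurable X]setTI; exact: measurable_free_flow.
rewrite !swap//; apply: eq_integral => v _ /=.
rewrite -(@lebesgue_rV_translation R n (t *: v) (ysection A v)); last first.
  exact: measurable_ysection.
by congr (mu _); apply/seteqP; split => x; rewrite /ysection /= !inE.
Qed.

Lemma ae_free_flow (t : R) (P : E * E -> Prop) :
  {ae mu2, forall z, P z} -> {ae mu2, forall z, P (free_flow t z)}.
Proof.
move=> [A [mA A0 PA]]; exists (free_flow t @^-1` A); split.
- by rewrite -[X in measurable X]setTI; exact: measurable_free_flow.
- by rewrite free_flow_measure.
- by move=> z Pz; exact: PA.
Qed.

End free_flow.

(** * Borel measurability of compact subsets of R^n *)

Section measurable_compact.
Context {R : realType} {n : nat}.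

Lemma measurable_mx_ball (x : 'rV[R]_n) (e : R) : measurable (ball x e).
Proof.
(* Nonpositive radii are treated apart: in dimension 0 the intersection over coordinates is the
   whole space, whereas the ball is empty. *)
have [e0|e0] := ltP 0 e; last first.
  by rewrite (_ : ball x e = set0) // -subset0 => y [/lt_geF]; rewrite e0.
rewrite (_ : ball x e =
    \bigcap_(i in [set: 'I_n]) (rV_coord i @^-1` ball (x ord0 i) e)).
  apply: fin_bigcap_measurable => // i _.
  rewrite -[X in measurable X]setTI; apply: measurable_rV_coord => //.
  exact: measurable_ball.
apply/seteqP; split => [y [_ xy] i _|y xy]; first exact: xy.
by split => // i j; rewrite ord1; exact: (xy j).
Qed.

(* A compact set is the intersection over k of finite unions of balls of radius
   1/(k+1) centred in it. *)
Lemma compact_rV_measurable (D : set 'rV[R]_n) : compact D -> measurable D.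
Proof.
move=> cD.
have net (k : nat) : exists F : set 'rV[R]_n, [/\ finite_set F,  F `<=` D &
    D `<=` \bigcup_(x in F) ball x k.+1%:R^-1].
  move: (cD); rewrite compact_cover => /(_ _ D (fun x => (ball x k.+1%:R^-1)^°)).
  case; first by move=> x _; exact: open_interior.
    move=> x Dx; exists x => //; apply: nbhsx_ballx.
    by rewrite invr_gt0.
  move=> F FD DF; exists [set` F]; split => //.
    by move=> x /FD; rewrite inE.
  by move=> x /DF [y yF /interior_subset xy]; exists y.
pose F k := projT1 (cid (net k)).
rewrite (_ : D = \bigcap_k \bigcup_(x in F k) ball x k.+1%:R^-1).
  apply: bigcap_measurable => // k _.
  rewrite /F; case: cid => /= G [finG _ _].
  by apply: fin_bigcup_measurable => // x _; exact: measurable_mx_ball.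
apply/seteqP; split => [x Dx k _|x Fx].
  by rewrite /F; case: cid => /= G [_ _]; exact.
(* Converse inclusion: a point within 1/(k+1) of [D] for every k is adherent to [D], which is
   closed. *)
have /closure_id -> : closed D.
  by apply: compact_closed => //; exact: norm_hausdorff.
move=> B /nbhs_ballP[e /= e0 eB].
have [k ke] : exists k : nat, k.+1%:R^-1 < e.
  have [k _ /(_ k (leqnn k))] := near_infty_natSinv_lt (PosNum e0).
  by exists k.
have [y Fy xy] := Fx k I; exists y; split.
  by move: Fy; rewrite /F; case: cid => /= G [_ GD _]; exact: GD.
by apply: eB; apply: (le_ball (ltW ke)); exact: ball_sym.
Qed.

End measurable_compact.

(** * Time integrals over half-lines, depending on a parameter *)

Lemma measurable_ge_fst {R : realType} {d : measure_display}
    {T : measurableType d} (t : R) :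
  measurable [set p : measurableTypeR R * T | t <= (p.1 : R)].
Proof.
rewrite (_ : mkset _ = `[t, +oo[%classic `*` setT).
  by apply: measurableX => //; exact: measurable_itv.
by apply/seteqP; split => -[s z]; rewrite /= in_itv/= andbT // => -[].
Qed.

Section half_line_integral.
Context {R : realType} {d : measure_display} {T : measurableType d}.
Local Notation leb := (@lebesgue_measure R).
Variable J : R -> T -> R.
Hypothesis mJ : measurable_fun
  [set p : measurableTypeR R * T | 0 <= (p.1 : R)] (fun p => J p.1 p.2).

Lemma measurable_fun_half_section (z : T) :
  measurable_fun (`[0, +oo[%classic : set (measurableTypeR R)) (J ^~ z).
Proof.
apply: (@measurable_comp _ _ _ _ _ _ _ (fun p => J p.1 p.2) _
  (fun s : measurableTypeR R => (s, z)) (measurable_ge_fst 0) _ mJ).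
  by move=> _ [s + <-]; rewrite /= in_itv/= andbT.
exact: (measurable_funTS (pair2_measurable z)).
Qed.

(** Extending the integrand by 0 before time [t] gives a partial integral over all of R, measurable
    by Tonelli. The function [g] will be the modulus, or the positive or negative part. *)
Lemma measurable_ge0_integral_half_line (t : R) (g : R -> \bar R) : 0 <= t ->
  measurable_fun setT g -> (forall x, 0 <= g x)%E ->
  measurable_fun setT (fun z => \int[leb]_(s in `[t, +oo[) g (J s z))%E.
Proof.
move=> t0 mg g0.
pose h (p : measurableTypeR R * T) : \bar R :=
  if t <= (p.1 : R) then g (J p.1 p.2) else 0%E.
have mh : measurable_fun setT h.
  rewrite (_ : h = (fun p => g (J p.1 p.2)) \_
      [set p : measurableTypeR R * T | t <= (p.1 : R)]); last first.
    by apply/funext => p; rewrite patchE /h mem_setE.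
  apply/(measurable_restrictT _ (measurable_ge_fst t)).
  have mJt : measurable_fun [set p : measurableTypeR R * T | t <= (p.1 : R)]
      (fun p => J p.1 p.2).
    by apply: (measurable_funS (measurable_ge_fst 0) _ mJ) => p /=; exact: le_trans.
  exact: (measurableT_comp mg mJt).
rewrite (_ : (fun z => _) = fubini_G leb h); last first.
  apply/funext => z; rewrite /fubini_G [LHS]integral_mkcond; apply: eq_integral => s _.
  by rewrite patchE /h/= mem_setE in_itv/= andbT.
by apply: measurable_fun_fubini_tonelli_G => // p; rewrite /h; case: ifP.
Qed.

Lemma measurable_Rintegral_half_line (t : R) : 0 <= t ->
  measurable_fun setT (fun z => \int[leb]_(s in `[t, +oo[) J s z).
Proof.
move=> t0; apply: (measurableT_comp (@fine_measurable R setT measurableT)).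
have pos (g : R -> \bar R) : measurable_fun setT g -> measurable_fun setT
    (fun z => \int[leb]_(s in `[t, +oo[) maxe (g (J s z)) 0)%E.
  move=> mg.
  apply: (measurable_ge0_integral_half_line t (fun x => maxe (g x) 0%E)) => //.
    exact: measurable_maxe.
  by move=> x; rewrite le_max lexx orbT.
rewrite (_ : (fun z => _) = (fun z =>
    \int[leb]_(s in `[t, +oo[) maxe (J s z)%:E 0 -
    \int[leb]_(s in `[t, +oo[) maxe (- (J s z)%:E) 0)%E); last first.
  apply/funext => z; rewrite integralE; congr (_ - _)%E; apply: eq_integral => s _.
    by rewrite funeposE.
  by rewrite funenegE.
apply: emeasurable_funB; first exact: (pos EFin).
by apply: (pos (fun x => - x%:E)%E); exact: measurableT_comp.
Qed.

(** When [J] is the interaction along characteristics, this is [abs_interaction]. *)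
Definition tail_integral (t : R) (z : T) : \bar R :=
  (\int[leb]_(s in `[t, +oo[) `|J s z|%:E)%E.

Lemma measurable_tail_integral (t : R) : 0 <= t ->
  measurable_fun setT (tail_integral t).
Proof.
move=> t0; apply: (measurable_ge0_integral_half_line t (fun x => `|x|%:E)) => //.
by apply/measurable_EFinP; exact: normr_measurable.
Qed.

Lemma tail_integral_ge0 (t : R) (z : T) : (0 <= tail_integral t z)%E.
Proof. by apply: integral_ge0 => s _; rewrite lee_fin. Qed.

Lemma tail_integral_le (t : R) (z : T) : 0 <= t ->
  (tail_integral t z <= tail_integral 0 z)%E.
Proof.
move=> t0; apply: ge0_subset_integral => //.
- by apply/measurable_EFinP; apply: measurableT_comp => //;
    exact: measurable_fun_half_section.
- by apply: subset_itvr; rewrite bnd_simp.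
Qed.

Section finite_tail.
Variable z : T.
Hypothesis fin0 : (tail_integral 0 z < +oo)%E.

Lemma integrable_half_line : leb.-integrable `[0, +oo[ (fun s => (J s z)%:E).
Proof.
apply/integrableP; split.
  by apply/measurable_EFinP; exact: measurable_fun_half_section.
by [].
Qed.

Lemma Rintegral_half_line_le :
  `|\int[leb]_(s in `[0, +oo[) J s z| <= fine (tail_integral 0 z).
Proof. exact: (le_normr_Rintegral _ integrable_half_line). Qed.

(** By additivity the difference is, up to sign, the integral over []t, +oo[], bounded by the
    integral of the modulus. *)
Lemma Rintegral_half_line_tail (t : R) : 0 <= t ->
  `|\int[leb]_(s in `[0, t]) J s z - \int[leb]_(s in `[0, +oo[) J s z| <=
  fine (tail_integral t z).
Proof.
move=> t0; rewrite distrC Rintegral_itvB ?bnd_simp//; last first.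
  exact: integrable_half_line.
have sub : `]t, +oo[ `<=` (`[0, +oo[%classic : set R).
  by apply: subset_itvr; rewrite bnd_simp.
apply: le_trans (le_normr_Rintegral _ _) _ => //.
  exact: integrableS integrable_half_line.
(* Adding the endpoint [t], a null set, turns the open half-line into the closed one of
   [tail_integral]. *)
rewrite Rintegral_itv_obnd_cbnd; first exact: lexx.
exact: integrableS (integrable_norm integrable_half_line).
Qed.

End finite_tail.
End half_line_integral.

(** * Solutions along characteristics and free transport *)

Section characteristics.
Context {R : realType} {n : nat}.
Local Notation E := 'rV[R]_n.
Local Notation leb := (@lebesgue_measure R).
Local Notation mu2 := (lebesgue_rV n \x lebesgue_rV n)%E.

Lemma free_flow0 (z : E * E) : free_flow 0 z = z.
Proof. by case: z => x v; rewrite /free_flow /= scale0r addr0. Qed.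

(** The map sending (s, z) to (s, [free_flow s z]) is jointly measurable and leaves the time
    coordinate unchanged. *)
Lemma measurable_along_flow (F : R -> E * E -> R) :
  measurable_fun [set p : measurableTypeR R * (E * E) | 0 <= (p.1 : R)]
    (fun p => F p.1 p.2) ->
  measurable_fun [set p : measurableTypeR R * (E * E) | 0 <= (p.1 : R)]
    (fun p => F p.1 (free_flow p.1 p.2)).
Proof.
move=> mF.
have mflow : measurable_fun setT (fun p : measurableTypeR R * (E * E) =>
    (p.1, free_flow p.1 p.2)).
  apply: measurable_fun_pair; first exact: measurable_fst.
  apply: measurable_fun_pair; last first.
    exact: (measurableT_comp measurable_snd measurable_snd).
  apply: measurable_fun_rVP => i.
  rewrite (_ : _ \o _ = fun p : measurableTypeR R * (E * E) =>
      (rV_coord i p.2.1 : R) + (p.1 : R) * (rV_coord i p.2.2 : R)); last first.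
    by apply/funext => p; rewrite /rV_coord /= !mxE.
  apply: measurable_funD => /=.
    apply: (measurableT_comp (measurable_rV_coord i)).
    exact: (measurableT_comp measurable_fst measurable_snd).
  apply: measurable_funM => /=; first exact: measurable_fst.
  apply: (measurableT_comp (measurable_rV_coord i)).
  exact: (measurableT_comp measurable_snd measurable_snd).
apply: (@measurable_comp _ _ _ _ _ _ _ (fun p => F p.1 p.2) _
  (fun p : measurableTypeR R * (E * E) => (p.1, free_flow p.1 p.2)) _ _ mF).
- exact: measurable_ge_fst.
- by move=> _ [p + <-].
- exact: measurable_funTS.
Qed.

(** At time 0 the integral runs over a single point, so [f 0 z = f0 z] almost everywhere. This
    replaces the datum [f0] by [f 0], the function whose norm enters [scattering_bound]. *)
Lemma solution_characteristic (I : interaction R n) f0 f : solution I f0 f ->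
  {ae mu2, forall z, forall t : R, 0 <= t ->
    f t (free_flow t z) =
    f 0 z + \int[leb]_(s in `[0, t]) I f s (free_flow s z)}.
Proof.
move=> [_ _ _]; apply: filterS => z sol t t0.
have [_ ->] := sol _ t0; have [_] := sol 0 (lexx 0).
by rewrite free_flow0 set_itv1 Rintegral_set1 addr0 => ->.
Qed.

Lemma transport_characteristic (g : @density R n) :
  solution no_interaction (g 0) g ->
  {ae mu2, forall z, forall t : R, 0 <= t -> g t (free_flow t z) = g 0 z}.
Proof.
move=> /solution_characteristic; apply: filterS => z sol t t0.
by rewrite sol//= Rintegral_cst// mul0r addr0.
Qed.

Lemma transport_solution (g : E * E -> R) : measurable_fun setT g ->
  solution no_interaction g (fun t z => g (free_flow (- t) z)).
Proof.
move=> mg; split => //.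
- by move=> t _; exact: (measurableT_comp mg (measurable_free_flow (- t))).
- apply: aeW => z t t0; split; first exact: integrable0.
  by rewrite free_flowK Rintegral_cst// mul0r addr0.
Qed.

Lemma measurable_cutoff (D : set E) (h : E * E -> R) : measurable D ->
  measurable_fun setT h -> measurable_fun setT (fun z => \1_D z.1 * h z).
Proof.
move=> mD mh; apply: measurable_funM => //.
exact: (measurableT_comp (measurable_indic mD) measurable_fst).
Qed.

End characteristics.

(** * The norm on functions with possibly infinite values *)

Section enorm.
Context {R : realType} {n : nat}.
Local Notation E := 'rV[R]_n.
Local Notation mu2 := (lebesgue_rV n \x lebesgue_rV n)%E.
Variable O : (E * E -> R) -> \bar R.

Lemma enormE (g : E * E -> \bar R) : {ae mu2, forall z, g z \is a fin_num} ->
  enorm O g = O (fine \o g).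
Proof. by move=> fg; rewrite /enorm asboolT. Qed.

Lemma enorm_lty (g : E * E -> \bar R) : (enorm O g < +oo)%E ->
  {ae mu2, forall z, g z \is a fin_num}.
Proof. by rewrite /enorm; case: asboolP. Qed.

End enorm.

(** * Existence: the scattering state, its norm and the convergence to it *)

Section scattering.
Context {R : realType} {n : nat}.
Local Notation E := 'rV[R]_n.
Local Notation leb := (@lebesgue_measure R).
Local Notation mu2 := (lebesgue_rV n \x lebesgue_rV n)%E.
Variables (I : interaction R n) (O : (E * E -> R) -> \bar R).
Variables (f0 : E * E -> R) (f : @density R n).
Hypothesis nO : function_norm O.
Hypothesis scat : scattering_solution I O f0 f.

Let J (s : R) (z : E * E) : R := I f s (free_flow s z).

Let mJ : measurable_fun
  [set p : measurableTypeR R * (E * E) | 0 <= (p.1 : R)] (fun p => J p.1 p.2).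
Proof. by apply: (measurable_along_flow (I f)); have [[]] := scat. Qed.

Let mf (t : R) : 0 <= t -> measurable_fun setT (f t).
Proof. by have [[mf _ _ _] _ _] := scat; exact: mf. Qed.

Let A_ge0 (t : R) z : (0 <= abs_interaction I f t z)%E.
Proof. exact: (tail_integral_ge0 J). Qed.

Let mA (t : R) : 0 <= t -> measurable_fun setT (abs_interaction I f t).
Proof. exact: (measurable_tail_integral J mJ). Qed.

(** As [O (f 0)] is nonnegative, a finite [scattering_bound] makes the [enorm] of the total
    interaction finite, which forces finiteness almost everywhere. *)
Let A_fin : {ae mu2, forall z, (abs_interaction I f 0 z < +oo)%E}.
Proof.
have [_ finN _] := scat.
have : (enorm O (abs_interaction I f 0) < +oo)%E.
  apply: le_lt_trans finN; rewrite leeDr//.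
  exact: (fnorm_ge0 nO (mf _ (lexx 0))).
by move=> /enorm_lty; apply: filterS => z; rewrite ge0_fin_numE.
Qed.

Let A_finite (t : R) : 0 <= t ->
  {ae mu2, forall z, abs_interaction I f t z \is a fin_num}.
Proof.
move=> t0; move: A_fin; apply: filterS => z Az.
by rewrite ge0_fin_numE//; exact: le_lt_trans (tail_integral_le J mJ _ z t0) Az.
Qed.

(** The real-valued integral is total, so this is defined everywhere; only its values off the null
    set of infinite total interaction matter. *)
Definition scattering_state (z : E * E) : R :=
  f 0 z + \int[leb]_(s in `[0, +oo[) I f s (free_flow s z).

Lemma measurable_scattering_state : measurable_fun setT scattering_state.
Proof.
apply: measurable_funD; first exact: mf.
exact: (measurable_Rintegral_half_line J mJ).
Qed.

Lemma scattering_state_le : (O scattering_state <= scattering_bound I O f)%E.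
Proof.
rewrite /scattering_bound enormE; last exact: A_finite.
have mf0 : measurable_fun setT (fun z => `|f 0 z|).
  by apply: measurableT_comp => //; exact: mf.
have mA0 : measurable_fun setT (fine \o abs_interaction I f 0).
  by apply: measurableT_comp => //; exact: mA.
apply: (@le_trans _ _ (O (fun z => `|f 0 z| + (fine \o abs_interaction I f 0) z))).
  apply: (fnorm_le nO measurable_scattering_state).
    exact: measurable_funD.
  move: A_fin; apply: filterS => z Az.
  rewrite [leRHS]ger0_norm; last by rewrite addr_ge0// fine_ge0.
  apply: (le_trans (ler_normD _ _)); rewrite lerD2l.
  exact: (Rintegral_half_line_le J mJ).
apply: (le_trans (fnormD nO mf0 mA0)); apply: leeD => //.
(* Monotonicity in the modulus bounds the norm of [|f 0|] by that of [f 0]. *)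
apply: (fnorm_le nO mf0 (mf _ (lexx 0))).
by apply: aeW => z; rewrite normr_id.
Qed.

(** The norm is squeezed between 0 and the [enorm] of the cut-off tail, which tends to 0 because a
    compact set is bounded and measurable. *)
Lemma scattering_state_cvg (D : set E) : compact D ->
  O (fun z => \1_D z.1 * (f t (free_flow t z) - scattering_state z))
    @[t --> +oo] --> 0%E.
Proof.
move=> cD; have mD := compact_rV_measurable D cD.
have [sol _ /(_ D (compact_bounded cD) mD) tail0] := scat.
have mdiff (t : R) : 0 <= t -> measurable_fun setT
    (fun z => f t (free_flow t z) - scattering_state z).
  move=> t0; apply: measurable_funB measurable_scattering_state.
  exact: (measurableT_comp (mf _ t0) (measurable_free_flow t)).
apply: squeeze_cvge (cvg_cst 0%E) tail0.
near=> t.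
have t0 : 0 <= t by near: t; exact: nbhs_pinfty_ge.
have mcut := measurable_cutoff D _ mD (mdiff _ t0).
rewrite (fnorm_ge0 nO mcut)/=.
have mcutA : measurable_fun setT
    (fine \o (fun z => (\1_D z.1)%:E * abs_interaction I f t z)%E).
  apply: measurableT_comp => //; apply: emeasurable_funM; last exact: mA.
  apply/measurable_EFinP.
  exact: (measurableT_comp (measurable_indic mD) measurable_fst).
rewrite enormE; last first.
  by move: (A_finite _ t0); apply: filterS => z Az; exact: fin_numM.
apply: (fnorm_le nO mcut mcutA).
(* Finiteness at time 0 gives integrability on the half-line, finiteness at [t] lets [fine] pass
   through the product with the cutoff, and the characteristic identity makes the terms [f 0 z]
   cancel. *)
move: A_fin (A_finite _ t0) (solution_characteristic _ _ _ sol).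
apply: filterS3 => z A0 At ft.
rewrite /= fineM// !normrM ler_wpM2l// ft//.
rewrite /scattering_state opprD addrACA subrr add0r.
rewrite [leRHS]ger0_norm ?fine_ge0//.
exact: (Rintegral_half_line_tail J mJ).
Unshelve. all: by end_near. Qed.

End scattering.

(** * Uniqueness of the limit, by exhaustion with compact cubes *)

Section uniqueness.
Context {R : realType} {n : nat}.
Local Notation E := 'rV[R]_n.
Local Notation mu2 := (lebesgue_rV n \x lebesgue_rV n)%E.
Variable O : (E * E -> R) -> \bar R.
Hypothesis nO : function_norm O.

Definition box (k : nat) : set E :=
  [set x | forall i, `[- k%:R, k%:R]%classic (x ord0 i)].

Lemma compact_box k : compact (box k).
Proof.
apply: (@rV_compact R n (fun=> `[- k%:R, k%:R]%classic)) => _.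
exact: segment_compact.
Qed.

Lemma box_cover (x : E) : exists k, box k x.
Proof.
(* This integer exceeds the maximum norm of [x], hence every coordinate in absolute value. *)
exists (Num.truncn `|x|).+1 => i; rewrite /= in_itv/= -ler_norml.
apply: le_trans (ltW (truncnS_gt _)).
by rewrite [leRHS]/Num.norm/= mx_normrE; exact: (le_bigmax _ _ (ord0, i)).
Qed.

(** On a cube, a - b = -(h - a) + (h - b), so the norm of the cut-off difference, independent of t,
    is at most a sum tending to 0. Definiteness gives equality almost everywhere on each cube, and
    countably many null sets are discarded. *)
Lemma scattering_limit_unique (h : R -> E * E -> R) (a b : E * E -> R) :
  (forall t : R, 0 <= t -> measurable_fun setT (h t)) ->
  measurable_fun setT a -> measurable_fun setT b ->
  (forall D : set E, compact D ->
    O (fun z => \1_D z.1 * (h t z - a z)) @[t --> +oo] --> 0%E) ->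
  (forall D : set E, compact D ->
    O (fun z => \1_D z.1 * (h t z - b z)) @[t --> +oo] --> 0%E) ->
  {ae mu2, forall z, a z = b z}.
Proof.
move=> mh ma mb ha hb.
have ab_box k : {ae mu2, forall z, \1_(box k) z.1 * (a z - b z) = 0}.
  have cD := compact_box k; have mD := compact_rV_measurable _ cD.
  have mab := measurable_cutoff _ _ mD (measurable_funB ma mb).
  apply: (fnorm_eq0 nO mab); apply/eqP; rewrite eq_le (fnorm_ge0 nO mab) andbT.
  have cvg0 : (O (fun z => (\1_(box k) z.1 * (h t z - a z))%R) +
      O (fun z => (\1_(box k) z.1 * (h t z - b z))%R))%E @[t --> +oo] --> 0%E.
    rewrite -[X in _ --> X]adde0.
    apply: cvgeD; [by []|exact: ha|exact: hb].
  rewrite -(cvg_lim _ cvg0)//; apply: lime_ge; first by apply/cvg_ex; exists 0%E.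
  near=> t.
  have t0 : 0 <= t by near: t; exact: nbhs_pinfty_ge.
  have mha := measurable_cutoff _ _ mD (measurable_funB (mh _ t0) ma).
  have mhb := measurable_cutoff _ _ mD (measurable_funB (mh _ t0) mb).
  have -> : (fun z => \1_(box k) z.1 * (a z - b z)) =
      fun z => -1 * (\1_(box k) z.1 * (h t z - a z)) +
        \1_(box k) z.1 * (h t z - b z).
    apply/funext => z.
    by rewrite mulN1r -mulrN opprB -mulrDr; congr (_ * _); rewrite addrA subrK.
  apply: (le_trans (fnormD nO _ mhb)); first exact: measurable_funM.
  by rewrite (fnormZ nO)// normrN1 mul1e.
move: (ae_foralln ab_box); apply: filterS => z ab.
have [k kz] := box_cover z.1; move: (ab k).
by rewrite indicE mem_set// mul1r => /eqP; rewrite subr_eq0 => /eqP.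
Unshelve. all: by end_near. Qed.

End uniqueness.

(** * The scattering state carried by free transport, at all times *)

Theorem theorem3p1 (R : realType) (n : nat) (I : interaction R n)
    (normO : ('rV[R]_n * 'rV[R]_n -> R) -> \bar R)
    (f0 : 'rV[R]_n * 'rV[R]_n -> R) (f : @density R n) (N : R) :
  mesoscopic I ->
  observer_norm I normO ->
  scattering_solution I normO f0 f ->
  scattering_bound I normO f = N%:E ->
  exists finf : density,
    [/\ solution no_interaction (finf 0) finf,
        scattering_space normO N finf &
        scatters_to normO f finf] /\
    (forall g : density,
        solution no_interaction (g 0) g ->
        scattering_space normO N g ->
        scatters_to normO f g ->
        forall t : R, 0 <= t ->
        {ae (lebesgue_rV n \x lebesgue_rV n)%E, forall z, g t z = finf t z}).
Proof.
move=> _ obs scat scatN.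
have nO := observer_norm_norm obs.
pose G := scattering_state I f.
have mG : measurable_fun setT G := measurable_scattering_state I normO f0 f scat.
pose finf (t : R) z := G (free_flow (- t) z).
have finf0 : finf 0 = G by apply/funext => z; rewrite /finf oppr0 free_flow0.
have mf (t : R) : 0 <= t -> measurable_fun setT (f t \o free_flow t).
  move=> t0; have [[mf _ _ _] _ _] := scat.
  exact: (measurableT_comp (mf _ t0) (measurable_free_flow t)).
exists finf; split; [split|].
- by rewrite finf0; exact: transport_solution.
- split=> [t _|].
    exact: (measurableT_comp mG (measurable_free_flow (- t))).
  apply: ge_ereal_sup => _ [t /= t0 <-].
  (* Along the flow [finf] is constantly [G], so every term of the supremum is the norm of [G]. *)
  rewrite (_ : _ \o _ = G); last first.
    by apply/funext => z /=; rewrite /finf free_flowK.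
  by rewrite -scatN; exact: (scattering_state_le I normO f0 f).
- rewrite /scatters_to finf0 => D cD.
  exact: (scattering_state_cvg I normO f0 f).
- move=> g solg _ gscat t t0.
  have gG : {ae (lebesgue_rV n \x lebesgue_rV n)%E, forall z, g 0 z = G z}.
    apply: (scattering_limit_unique normO nO (fun t => f t \o free_flow t)) => //.
    + by have [+ _ _ _] := solg; exact.
    + by move=> D cD; exact: (scattering_state_cvg I normO f0 f).
  have trG : {ae (lebesgue_rV n \x lebesgue_rV n)%E,
      forall z, g t (free_flow t z) = G z}.
    move: (transport_characteristic g solg) gG.
    by apply: filterS2 => z gt <-; exact: gt.
  (* Substituting [free_flow (- t) z] for [z] keeps null sets null and turns the identity along
     characteristics into [g t z = finf t z]. *)
  move: (ae_free_flow (- t) _ trG); apply: filterS => z.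
  by rewrite free_flowNK.
Qed.
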